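(* Let $I$ be a countable index set and let $\mathbf X=(X_i)_{i\in I}$ be a family of random elements, defined on a common probability space, taking values in a POP space $(\mathbb X,\preceq)$. Assume that for every finite $J\subset I$ the finite subfamily $X_J=(X_i)_{i\in J}$ is negatively associated. Then $\mathbf X$ is negatively associated. Likewise, if $X_J$ is positively associated for every finite $J\subset I$, then $\mathbf X$ is positively associated.
   Context: A POP space is a Polish space $\mathbb X$ with Borel $\sigma$-field $\mathcal X$, equipped with a partial order $\preceq$ that is closed, i.e. $\{(x,x'):x\preceq x'\}$ is closed in $\mathbb X^2$. For $J\subset I$ write $X_J=(X_i)_{i\in J}$, a random element of $\mathbb X^J$ (product topology and product Borel $\sigma$-field). $\mathbb X^J$ is ordered coordinatewise, and a function $f:\mathbb X^J\to\mathbb R$ is non-decreasing if $x\preceq y$ coordinatewise implies $f(x)\le f(y)$. A family $\mathbf X=(X_i)_{i\in I}$ is negatively associated (NA) if $\mathbb E[f(X_J)g(X_{I\setminus J})]\le \mathbb E[f(X_J)]\,\mathbb E[g(X_{I\setminus J})]$ for all $J\subset I$ and all bounded measurable non-decreasing $f:\mathbb X^J\to\mathbb R$, $g:\mathbb X^{I\setminus J}\to\mathbb R$. It is positively associated (PA) if $\mathbb E[f(X_J)g(X_J)]\ge \mathbb E[f(X_J)]\,\mathbb E[g(X_J)]$ for all $J\subset I$ and all bounded measurable non-decreasing $f,g:\mathbb X^J\to\mathbb R$. *)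

(* Defs.v *)
From HB Require Import structures.
From mathcomp Require Import all_boot all_order all_algebra.
From mathcomp Require Import all_classical all_reals all_analysis.
Set Implicit Arguments. Unset Strict Implicit. Unset Printing Implicit Defensive.
Import Order.TTheory GRing.Theory Num.Theory.
Import numFieldTopology.Exports numFieldNormedType.Exports.
Local Open Scope classical_set_scope.
Local Open Scope ring_scope.

Definition borel (T : topologicalType) : set (set T) :=
  <<s [set U : set T | open U] >>.

(* Polish space: a (Hausdorff) complete metric space that is separable.
   The topology of T is the one induced by its complete (pseudo)metric. *)
Definition polish (R : realType) (T : completePseudoMetricType R) : Prop :=
  hausdorff_space T /\ exists D : set T, countable D /\ closure D = [set: T].

Definition closed_partial_order (T : topologicalType) (le : T -> T -> Prop) :=
  [/\ (forall x, le x x),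
      (forall x y, le x y -> le y x -> x = y),
      (forall x y z, le x y -> le y z -> le x z) &
      closed [set p : T * T | le p.1 p.2]].

Definition POP (R : realType) (T : completePseudoMetricType R)
  (le : T -> T -> Prop) := polish T /\ closed_partial_order le.

Definition prod_sigma (K : Type) (T : topologicalType) : set (set (K -> T)) :=
  <<s [set A | exists (k : K) (B : set T), @borel T B /\
                 A = (fun x : K -> T => x k) @^-1` B] >>.

Definition bmn_fun (R : realType) (K : Type) (T : topologicalType)
  (le : T -> T -> Prop) (f : (K -> T) -> R) : Prop :=
  [/\ (exists M : R, forall x, `|f x| <= M),
      (forall B : set R, borel (B : set R) -> @prod_sigma K T (f @^-1` B)) &
      (forall x y : K -> T, (forall k, le (x k) (y k)) -> f x <= f y)].

Definition random_element d (Omega : measurableType d) (T : topologicalType)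
  (Y : Omega -> T) : Prop :=
  forall B : set T, @borel T B -> measurable (Y @^-1` B).

Definition subfam (I : Type) (Omega T : Type) (X : I -> Omega -> T) (J : set I)
  : Omega -> ({i : I | J i} -> T) :=
  fun w j => X (proj1_sig j) w.
Arguments subfam {I Omega T} X J w j.

Local Open Scope ereal_scope.

Definition negatively_associated (R : realType) d (Omega : measurableType d)
  (P : probability Omega R) (T : topologicalType) (le : T -> T -> Prop)
  (I : Type) (X : I -> Omega -> T) : Prop :=
  forall (J : set I) (f : ({i : I | J i} -> T) -> R)
         (g : ({i : I | ~ J i} -> T) -> R),
    bmn_fun le f -> bmn_fun le g ->
    \int[P]_w (f (subfam X J w) * g (subfam X (~` J) w))%R%:E
      <= (\int[P]_w (f (subfam X J w))%:E) * (\int[P]_w (g (subfam X (~` J) w))%:E).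

Definition positively_associated (R : realType) d (Omega : measurableType d)
  (P : probability Omega R) (T : topologicalType) (le : T -> T -> Prop)
  (I : Type) (X : I -> Omega -> T) : Prop :=
  forall (J : set I) (f g : ({i : I | J i} -> T) -> R),
    bmn_fun le f -> bmn_fun le g ->
    (\int[P]_w (f (subfam X J w))%:E) * (\int[P]_w (g (subfam X J w))%:E)
      <= \int[P]_w (f (subfam X J w) * g (subfam X J w))%R%:E.

(* Main.v *)
(* For an upper set A in a countable product and a compact C inside A with
   nearly the same probability (Ulam), the upper closure of C lies between C
   and A.  By compactness it is the decreasing intersection, over finite sets F
   of coordinates, of the cylinders {y | exists x in C, x <= y on F}, whose bases
   are closed upper sets in finitely many coordinates.  Hence A is approximated
   in probability by finite-dimensional upper sets, and covariances of indicators
   of upper sets inherit their sign from the finite subfamilies.  Bounded monotone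
   functions are uniform limits of affine combinations, with nonnegative weights,
   of the indicators of their superlevel sets, which are upper sets. *)
Require Import Defs.
From HB Require Import structures.
From mathcomp Require Import all_boot all_order all_algebra.
From mathcomp Require Import all_classical all_reals all_analysis.
From mathcomp Require Import measurable_realfun ring lra.
Set Implicit Arguments. Unset Strict Implicit. Unset Printing Implicit Defensive.
Import Order.TTheory GRing.Theory Num.Theory.
Import numFieldTopology.Exports numFieldNormedType.Exports.
Local Open Scope classical_set_scope.
Local Open Scope ring_scope.

(** * Covariances of bounded measurable functions and reduction to superlevel sets *)

Section BoundedCovariance.
Context {R : realType} {d : measure_display} {Omega : measurableType d}.
Variable P : probability Omega R.

Definition bounded_measurable (U : Omega -> R) :=
  measurable_fun setT U /\ exists M : R, forall w, `|U w| <= M.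

Definition cov (U V : Omega -> R) : R :=
  \int[P]_w (U w * V w) - (\int[P]_w U w) * (\int[P]_w V w).

Lemma bounded_measurable_integrable U :
  bounded_measurable U -> P.-integrable setT (EFin \o U).
Proof.
move=> [mU [M UM]]; apply: measurable_bounded_integrable => //.
  exact: (le_lt_trans (probability_le1 _ _)) (ltry _).
by exists M; split; [exact: num_real | move=> x Mx w _ /=; exact: le_trans (ltW Mx)].
Qed.

Lemma bounded_measurable_cst (r : R) : bounded_measurable (fun=> r).
Proof. by split; [exact: measurable_cst | exists `|r|]. Qed.

Lemma bounded_measurableD U V : bounded_measurable U -> bounded_measurable V ->
  bounded_measurable (fun w => U w + V w).
Proof.
move=> [mU [M UM]] [mV [N VN]]; split; first exact: measurable_funD.
by exists (M + N) => w; rewrite (le_trans (ler_normD _ _))// lerD.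
Qed.

Lemma bounded_measurableM U V : bounded_measurable U -> bounded_measurable V ->
  bounded_measurable (fun w => U w * V w).
Proof.
move=> [mU [M UM]] [mV [N VN]]; split; first exact: measurable_funM.
by exists (M * N) => w; rewrite normrM ler_pM.
Qed.

Lemma bounded_measurableB U V : bounded_measurable U -> bounded_measurable V ->
  bounded_measurable (fun w => U w - V w).
Proof.
move=> [mU [M UM]] [mV [N VN]]; split; first exact: measurable_funB.
by exists (M + N) => w; rewrite (le_trans (ler_normB _ _))// lerD.
Qed.

Lemma bounded_measurable_norm U : bounded_measurable U ->
  bounded_measurable (fun w => `|U w|).
Proof.
move=> [mU [M UM]]; split; first exact: measurableT_comp.
by exists M => w; rewrite normr_id.
Qed.

Lemma bounded_measurable_indic (A : set Omega) : measurable A ->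
  bounded_measurable (\1_A).
Proof.
move=> mA; split; first exact: measurable_indic.
by exists 1 => w; rewrite indicE; case: (_ \in _); rewrite ?normr1 ?normr0.
Qed.

Lemma covC U V : cov U V = cov V U.
Proof.
rewrite /cov; congr (_ - _); last exact: mulrC.
by apply: eq_Rintegral => w _; exact: mulrC.
Qed.

Lemma probability_Rintegral_cst (r : R) : \int[P]_w r = r.
Proof.
rewrite Rintegral_cst//.
by rewrite (congr1 (fun x => r * fine x) (probability_setT P))/= mulr1.
Qed.

Lemma cov_cstl r V : bounded_measurable V -> cov (fun=> r) V = 0.
Proof.
move=> /bounded_measurable_integrable iV.
by rewrite /cov RintegralZl// probability_Rintegral_cst subrr.
Qed.

Lemma covDl U U' V : bounded_measurable U -> bounded_measurable U' ->
  bounded_measurable V -> cov (fun w => U w + U' w) V = cov U V + cov U' V.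
Proof.
move=> bU bU' bV; rewrite /cov RintegralD//; try exact: bounded_measurable_integrable.
have -> : \int[P]_w ((U w + U' w) * V w) = \int[P]_w (U w * V w + U' w * V w).
  by apply: eq_Rintegral => w _; rewrite mulrDl.
rewrite RintegralD//; first ring.
all: by apply: bounded_measurable_integrable; exact: bounded_measurableM.
Qed.

Lemma covZl (r : R) U V : bounded_measurable U -> bounded_measurable V ->
  cov (fun w => r * U w) V = r * cov U V.
Proof.
move=> bU bV; rewrite /cov RintegralZl//; last exact: bounded_measurable_integrable.
have -> : \int[P]_w (r * U w * V w) = \int[P]_w (r * (U w * V w)).
  by apply: eq_Rintegral => w _; rewrite mulrA.
rewrite RintegralZl//; first ring.
by apply: bounded_measurable_integrable; exact: bounded_measurableM.
Qed.

Lemma covBl U U' V : bounded_measurable U -> bounded_measurable U' ->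
  bounded_measurable V -> cov (fun w => U w - U' w) V = cov U V - cov U' V.
Proof.
move=> bU bU' bV.
have -> : (fun w => U w - U' w) = (fun w => U w + -1 * U' w).
  by apply/funext => w; rewrite mulN1r.
rewrite covDl ?covZl ?mulN1r//.
exact: (bounded_measurableM (bounded_measurable_cst (-1)) bU').
Qed.

(** Both the mean of the product and the product of the means are at most [M] times the L1 norm of
    [U]; this accounts for the factor 2. *)
Lemma cov_normr_le U V (M : R) : bounded_measurable U -> bounded_measurable V ->
  (forall w, `|V w| <= M) -> `|cov U V| <= 2 * M * \int[P]_w `|U w|.
Proof.
move=> bU bV VM.
have M0 : 0 <= M by exact: le_trans (normr_ge0 _) (VM point).
have bnU := bounded_measurable_norm bU.
have iU := bounded_measurable_integrable bnU.
have iUV := bounded_measurable_integrable (bounded_measurableM bU bV).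
have UV : `|\int[P]_w (U w * V w)| <= M * \int[P]_w `|U w|.
  rewrite -RintegralZl//; apply: le_trans (le_normr_Rintegral _ _) _ => //.
  apply: le_Rintegral => //.
  - exact: (bounded_measurable_integrable
      (bounded_measurable_norm (bounded_measurableM bU bV))).
  - exact: (bounded_measurable_integrable
      (bounded_measurableM (bounded_measurable_cst M) bnU)).
  - by move=> w _; rewrite normrM mulrC ler_wpM2r.
have UV' : `|(\int[P]_w U w) * (\int[P]_w V w)| <= M * \int[P]_w `|U w|.
  rewrite normrM mulrC ler_pM//.
  - apply: (@le_trans _ _ (\int[P]_w `|V w|)).
      by apply: le_normr_Rintegral => //; exact: bounded_measurable_integrable.
    apply: (@le_trans _ _ (\int[P]_w M)).
      apply: le_Rintegral => //; apply: bounded_measurable_integrable.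
        exact: bounded_measurable_norm.
      exact: bounded_measurable_cst.
    by rewrite probability_Rintegral_cst.
  - by apply: le_normr_Rintegral => //; exact: bounded_measurable_integrable.
by apply: (le_trans (ler_normB _ _)); rewrite -mulrA; lra.
Qed.

(* The second alternative only carries the induction. *)
Lemma staircase_approx (v de : R) n : 0 <= v -> 0 < de ->
  let S := de * \sum_(k < n) ((k%:R * de < v)%R)%:R in
  (v <= n%:R * de /\ v <= S <= v + de) \/ (n%:R * de < v /\ S = n%:R * de).
Proof.
move=> v0 de0; elim: n => [|n]/=.
  rewrite big_ord0 mulr0 mul0r; case: (ltP 0 v) => [|v0']; [by right|left].
  by split=> //=; lra.
rewrite big_ord_recr/= mulrDr -natr1 mulrDl mul1r.
set S := _ * \sum_(_ < _) _.
case=> [[vn /andP[vS Sv]]|[nv ->]].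
  by left; rewrite ltNge vn/= mulr0 addr0 vS Sv; split=> //; rewrite (le_trans vn)// lerDl ltW.
rewrite nv mulr1; case: (ltP (n%:R * de + de) v) => H; [by right|left].
by split=> //=; lra.
Qed.

Lemma bounded_measurable_sum n (F : 'I_n -> Omega -> R) :
  (forall k, bounded_measurable (F k)) ->
  bounded_measurable (fun w => \sum_(k < n) F k w).
Proof.
elim: n F => [F _|n ih F bF].
  under eq_fun do rewrite big_ord0.
  exact: bounded_measurable_cst.
under eq_fun do rewrite big_ord_recr/=.
by apply: bounded_measurableD => //; exact: ih.
Qed.

Lemma cov_suml n (F : 'I_n -> Omega -> R) V :
  (forall k, bounded_measurable (F k)) -> bounded_measurable V ->
  cov (fun w => \sum_(k < n) F k w) V = \sum_(k < n) cov (F k) V.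
Proof.
move=> + bV; elim: n F => [F _|n ih F bF].
  by rewrite big_ord0; under eq_fun do rewrite big_ord0; exact: cov_cstl.
rewrite big_ord_recr/= -ih// -covDl//; last exact: bounded_measurable_sum.
by under eq_fun do rewrite big_ord_recr/=.
Qed.

Lemma measurable_superlevel (U : Omega -> R) (t : R) : measurable_fun setT U ->
  measurable [set w | t < U w].
Proof.
move=> mU; have := mU measurableT `]t, +oo[%classic (measurable_itv _).
rewrite setTI; congr measurable; apply/seteqP; split => w /=;
  by rewrite in_itv/= andbT.
Qed.

(** [U] is uniformly within [de] of a constant plus a nonnegative combination of indicators of its
    superlevel sets. The constant has covariance zero with [V], the indicators contribute with the
    right sign, and the error is controlled by [cov_normr_le]. The factor [s] serves both signs at
    once: -1 for negative and 1 for positive association. *)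
Lemma cov_superlevel_ge0 (s : R) U V :
  bounded_measurable U -> bounded_measurable V ->
  (forall t, 0 <= s * cov (\1_[set w | t < U w]) V) -> 0 <= s * cov U V.
Proof.
move=> bU bV sUV; have [mU [M0 UM0]] := bU; have [mV [N VN]] := bV.
have N0 : 0 <= N by exact: le_trans (normr_ge0 _) (VN point).
(* Adding 1 makes [M] positive even when [U] vanishes, so that the step height [de] is positive. *)
pose M := M0 + 1.
have M_gt0 : 0 < M.
  by rewrite /M ltr_wpDl// (le_trans (normr_ge0 _) (UM0 point)).
have UM w : `|U w| <= M by rewrite (le_trans (UM0 w))// /M lerDl.
apply/ler_addgt0Pl => e e0.
(* A uniform error [de] in [U] changes [s * cov U V] by at most [|s| * (2 * N) * de]. The added 1
   makes [C] positive, and [n] is chosen so that [de * C <= e], where [n] steps of height [de] cover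
   the interval from [-M] to [M]. *)
pose C := `|s| * (2 * N) + 1.
have C0 : 0 < C by rewrite ltr_wpDl// mulr_ge0// mulr_ge0.
pose n := (Num.truncn (2 * M * C / e)).+1.
pose de := 2 * M / n%:R.
have n0 : 0 < n%:R :> R by rewrite ltr0n.
have de0 : 0 < de by rewrite divr_gt0// mulr_gt0.
have deC : de * C <= e.
  rewrite /de mulrAC ler_pdivrMr// [e * _]mulrC -ler_pdivrMr//.
  by apply/ltW; exact: truncnS_gt.
have nde : n%:R * de = 2 * M by rewrite /de mulrC divfK// gt_eqF.
pose F (k : 'I_n) : Omega -> R := \1_[set w | - M + k%:R * de < U w].
have bF k : bounded_measurable (F k).
  by apply: bounded_measurable_indic; exact: measurable_superlevel.
pose S w := - M + de * \sum_(k < n) F k w.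
have bS1 : bounded_measurable (fun w => de * \sum_(k < n) F k w).
  apply: bounded_measurableM; first exact: bounded_measurable_cst.
  exact: bounded_measurable_sum.
have bS : bounded_measurable S.
  by apply: bounded_measurableD => //; exact: bounded_measurable_cst.
have US w : `|U w - S w| <= de.
  have v0 : 0 <= U w + M by move: (UM w); rewrite ler_norml => /andP[? _]; lra.
  have vn : U w + M <= n%:R * de.
    by rewrite nde; move: (UM w); rewrite ler_norml => /andP[_ ?]; lra.
  have FE : \sum_(k < n) F k w = \sum_(k < n) ((k%:R * de < U w + M)%R)%:R.
    apply: eq_bigr => k _; rewrite /F indicE mem_setE/=; congr (_ %:R).
    by congr nat_of_bool; rewrite -ltrBDr addrC.
  (* The staircase is applied to [U w + M], which lies between 0 and [n * de]; this excludes the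
     second alternative. *)
  rewrite /S FE; have [[_ /andP[h1 h2]]|[h1 _]] := staircase_approx n v0 de0.
    by rewrite ler_norml; apply/andP; split; lra.
  by move: vn; rewrite leNgt h1.
have -> : cov U V = cov (fun w => U w - S w) V + cov S V by rewrite covBl// subrK.
have covS : cov S V = de * \sum_(k < n) cov (F k) V.
  rewrite /S covDl//; last exact: bounded_measurable_cst.
  rewrite cov_cstl// add0r covZl ?cov_suml//.
  exact: bounded_measurable_sum.
have h1 : 0 <= s * cov S V.
  rewrite covS mulrCA; apply: mulr_ge0; first exact: ltW.
  by rewrite mulr_sumr; apply: sumr_ge0 => k _; exact: sUV.
have bUS := bounded_measurableB bU bS.
have h2 : `|s * cov (fun w => U w - S w) V| <= e.
  apply: le_trans deC; rewrite normrM.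
  have h3 := cov_normr_le bUS bV VN.
  have h4 : \int[P]_w `|U w - S w| <= de.
    apply: (@le_trans _ _ (\int[P]_w de)).
      apply: le_Rintegral => //; apply: bounded_measurable_integrable.
        exact: bounded_measurable_norm.
      exact: bounded_measurable_cst.
    by rewrite probability_Rintegral_cst.
  have h5 : `|cov (fun w => U w - S w) V| <= 2 * N * de.
    by apply: (le_trans h3); rewrite ler_wpM2l// mulr_ge0.
  apply: (@le_trans _ _ (`|s| * (2 * N * de))); first by rewrite ler_wpM2l.
  by rewrite /C; nra.
by rewrite mulrDr; move: h2; rewrite ler_norml => /andP[h2 _]; lra.
Qed.

(** The reduction to superlevel sets is made in each argument in turn, using the symmetry of the
    covariance. *)
Lemma cov_superlevels_ge0 (s : R) U V :
  bounded_measurable U -> bounded_measurable V ->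
  (forall t u, 0 <= s * cov (\1_[set w | t < U w]) (\1_[set w | u < V w])) ->
  0 <= s * cov U V.
Proof.
move=> bU bV sUV; apply: cov_superlevel_ge0 => // t; rewrite covC.
have bt : bounded_measurable (\1_[set w | t < U w]).
  by apply: bounded_measurable_indic; apply: measurable_superlevel; case: bU.
by apply: cov_superlevel_ge0 => // u; rewrite covC.
Qed.

(** The L1 distance of two indicators is the probability of the symmetric difference. Passing
    through the pair [A'], [B] changes one set at a time, at a cost of [2 * e] each. *)
Lemma cov_indic_approx (A A' B B' : set Omega) (e : R) :
  measurable A -> measurable A' -> measurable B -> measurable B' ->
  (P (A `+` A') <= e%:E)%E -> (P (B `+` B') <= e%:E)%E ->
  `|cov (\1_A) (\1_B) - cov (\1_A') (\1_B')| <= 4 * e.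
Proof.
move=> mA mA' mB mB' AA' BB'.
have intY X Y : measurable X -> measurable Y -> (P (X `+` Y) <= e%:E)%E ->
    \int[P]_w `|\1_X w - \1_Y w| <= e.
  move=> mX mY XY; have mXY : measurable (X `+` Y) by apply: measurableU; exact: measurableD.
  have -> : \int[P]_w `|\1_X w - \1_Y w : R| = \int[P]_w \1_(X `+` Y) w.
    apply: eq_Rintegral => w _; rewrite !indicE /setY in_setU !in_setD.
    case: (w \in X); case: (w \in Y) => /=;
      by rewrite ?subrr ?subr0 ?sub0r ?normrN ?normr1 ?normr0.
  rewrite /Rintegral integral_indic// setIT -lee_fin fineK//.
  by rewrite fin_num_measure.
have b1 (X : set Omega) w : `|\1_X w : R| <= 1.
  by rewrite indicE; case: (_ \in _); rewrite ?normr1 ?normr0.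
have [bA bA'] := (bounded_measurable_indic mA, bounded_measurable_indic mA').
have [bB bB'] := (bounded_measurable_indic mB, bounded_measurable_indic mB').
have h1 := cov_normr_le (bounded_measurableB bA bA') bB (b1 B).
have h2 := cov_normr_le (bounded_measurableB bB bB') bA' (b1 A').
have {h1} := le_trans h1 (ler_wpM2l _ (intY _ _ mA mA' AA')).
have {h2} := le_trans h2 (ler_wpM2l _ (intY _ _ mB mB' BB')).
rewrite !covBl// ![cov _ \1_A']covC mulr1 => /(_ (ler0n _ 2)) h2 /(_ (ler0n _ 2)) h1.
have -> : cov \1_A \1_B - cov \1_A' \1_B' =
  (cov \1_A \1_B - cov \1_A' \1_B) + (cov \1_A' \1_B - cov \1_A' \1_B') by ring.
by apply: le_trans (ler_normD _ _) _; lra.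
Qed.

End BoundedCovariance.

(** * Continuity from above and countable subadditivity with geometric weights *)

Section SmallProbability.
Context {R : realType} {d : measure_display} {Omega : measurableType d}.
Variable P : probability Omega R.

Lemma probability_nonincreasing_small (F : nat -> set Omega) (e : R) :
  (forall n, measurable (F n)) -> nonincreasing_seq F ->
  \bigcap_n F n = set0 -> 0 < e ->
  exists N, forall n, (N <= n)%N -> (P (F n) <= e%:E)%E.
Proof.
move=> mF niF F0 e0.
have F0y : (P (F 0%N) < +oo)%E by exact: (le_lt_trans (probability_le1 _ _)) (ltry _).
have := @nonincreasing_cvg_mu _ _ _ P F F0y mF.
rewrite F0 measure0 => /(_ measurable0 niF) /fine_cvgP[_ /cvgrPdist_le/(_ _ e0)].
move=> [N _ NF]; exists N => n /NF /=.
rewrite sub0r normrN ger0_norm ?fine_ge0// => h.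
by rewrite -[P (F n)]fineK ?lee_fin// fin_num_measure.
Qed.

Lemma probability_bigcup_le (F : nat -> set Omega) (e : R) :
  (forall n, measurable (F n)) -> 0 <= e ->
  (forall n, (P (F n) <= (e / (2 ^ n.+1)%:R)%:E)%E) ->
  (P (\bigcup_n F n) <= e%:E)%E.
Proof.
move=> mF e0 Fe; apply: le_trans (epsilon_trick0 xpredT e0).
apply: (@le_trans _ _ (\sum_(n <oo) P (F n))%E); last first.
  by apply: lee_nneseries => // n _; exact: Fe.
by apply: measure_sigma_subadditive => //; exact: bigcup_measurable.
Qed.

End SmallProbability.

(** * Tightness of a single random element of a Polish space *)

Section PolishTightness.
Context {R : realType} {T : completePseudoMetricType R}.

Lemma polish_dense_seq : polish T ->
  exists D : nat -> T, forall x (e : R), 0 < e -> exists n, ball (D n) e x.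
Proof.
move=> [_ [A [/countable_injP[f finj] clA]]].
(* The injection [f] on the dense set [A] is inverted; an index that is not a value of [f] on [A]
   gets the default [point], which does no harm to density. *)
exists (fun n => xget point [set x | A x /\ f x = n]) => x e e0.
have : closure A x by rewrite clA.
move=> /(_ _ (nbhsx_ballx x e e0))[a [Aa xa]].
exists (f a); case: xgetP => [y _ [Ay fya]|/(_ a)]; last by case.
by rewrite (finj y a) ?inE//; exact: ball_sym.
Qed.

Lemma ultra_bigcup_ord (S : Type) (F : set_system S) (B : nat -> set S) n :
  UltraFilter F -> F [set x | exists2 i, (i < n)%N & B i x] ->
  exists i, F (B i).
Proof.
move=> FU; elim: n => [|n ih] FB.
  by have [x [i]] := filter_ex FB.
have [Bn|nBn] := in_ultra_setVsetC (B n) FU; first by exists n.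
apply: ih; apply: filterS (filterI FB nBn) => x [[i + Bi] nB].
rewrite ltnS leq_eqVlt => /predU1P[ein|]; last by exists i.
by move: nB; rewrite -ein.
Qed.

Lemma closure_ball_sub (x : T) (r : R) : 0 < r ->
  closure (ball x r) `<=` ball x (r + r).
Proof.
move=> r0 y /(_ _ (nbhsx_ballx y r r0))[z [xz /ball_sym yz]].
exact: ball_triangle xz yz.
Qed.

(** An ultrafilter on [K] contains one of the finitely many closed balls at each scale, hence is
    Cauchy. Completeness gives a limit, and closedness keeps it in [K]. *)
Lemma totally_bounded_closed_compact (D : nat -> T) (N : nat -> nat) :
  let K := \bigcap_k [set x | exists2 i, (i < N k)%N &
    closure (ball (D i) k.+1%:R^-1) x] in
  closed K -> compact K.
Proof.
move=> K clK; rewrite compact_ultra => F FU FK.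
have Fc : cauchy F.
  apply: cauchy_exP => e e0.
  (* Twice the radius has to fit into [e], since [closure_ball_sub] doubles it. *)
  have [k ke] : exists k, k.+1%:R^-1 + k.+1%:R^-1 <= e :> R.
    exists (Num.truncn (2 / e)); rewrite -mulr2n -[_ *+ 2]mulr_natl.
    rewrite ler_pdivrMr ?ltr0Sn// mulrC -ler_pdivrMr//.
    by apply/ltW; exact: truncnS_gt.
  have : F [set x | exists2 i, (i < N k)%N & closure (ball (D i) k.+1%:R^-1) x].
    by apply: filterS FK => x /(_ k I).
  move=> /ultra_bigcup_ord[i Fi]; exists (D i); apply: filterS Fi => y yi.
  by apply: le_ball ke _ _; apply: closure_ball_sub yi; rewrite invr_gt0.
have Fp : F --> lim F by exact: cauchy_cvg.
exists (lim F); split => //; apply: (clK) => B /Fp FB.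
by have [x ?] := filter_ex (filterI FK FB); exists x.
Qed.

Lemma bigcup_ord_closed (S : topologicalType) (B : nat -> set S) n :
  (forall i, closed (B i)) -> closed [set x | exists2 i, (i < n)%N & B i x].
Proof.
move=> cB; have -> : [set x | exists2 i, (i < n)%N & B i x] =
    \bigcup_(i in `I_n) B i.
  by apply/seteqP; split => x [i ? ?]; exists i.
by apply: closed_bigcup => //; exact: finite_II.
Qed.

Lemma open_borel (S : topologicalType) (U : set S) : open U -> borel U.
Proof. by move=> oU; exact: sub_sigma_algebra. Qed.

Lemma closed_borel (S : topologicalType) (C : set S) : closed C -> borel C.
Proof.
move=> cC; rewrite -[C]setCK -setTD; apply: sigma_algebraCD; apply: open_borel.
exact: closed_openC.
Qed.

(* Ulam's theorem. *)
Lemma random_element_tight d (Omega : measurableType d) (P : probability Omega R)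
  (Z : Omega -> T) (e : R) : polish T -> random_element Z -> 0 < e ->
  exists K : set T, [/\ compact K, closed K & (P (Z @^-1` (~` K)) <= e%:E)%E].
Proof.
move=> /polish_dense_seq[D dD] mZ e0.
pose B k i : set T := closure (ball (D i) k.+1%:R^-1).
pose U k n := [set x | exists2 i, (i < n)%N & B k i x].
have clU k n : closed (U k n).
  by apply: bigcup_ord_closed => i; exact: closed_closure.
have mU k n : measurable (Z @^-1` (~` U k n)).
  by apply: mZ; apply: open_borel; exact: closed_openC.
(* At a fixed scale [k] the sets [U k n] increase to the whole space by density, so finitely many
   balls miss little mass. The allowances sum to [e] over all scales. *)
have /choice[N NU] : forall k, exists n,
    (P (Z @^-1` (~` U k n)) <= (e / (2 ^ k.+1)%:R)%:E)%E.
  move=> k; have [|||N NP] := @probability_nonincreasing_small _ _ _ P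
    (fun n => Z @^-1` (~` U k n)) (e / (2 ^ k.+1)%:R) (mU k).
  - move=> m n mn; apply/subsetPset => w /= nU [i im Bi]; apply: nU.
    by exists i => //; exact: leq_trans mn.
  - rewrite -subset0 => w; have [|i Di] := dD (Z w) k.+1%:R^-1.
      by rewrite invr_gt0.
    by move=> /(_ i.+1 I)/=; apply; exists i => //; exact: subset_closure.
  - by rewrite divr_gt0// ltr0n expn_gt0.
  - by exists N; exact: NP.
pose K := \bigcap_k U k (N k).
have clK : closed K by apply: closed_bigI => k _; exact: clU.
exists K; split => //; first exact: totally_bounded_closed_compact clK.
have -> : Z @^-1` (~` K) = \bigcup_k (Z @^-1` (~` U k (N k))).
  by rewrite /K setC_bigcap preimage_bigcup.
by apply: probability_bigcup_le => //; exact: ltW.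
Qed.

End PolishTightness.

(** * The product sigma-field *)

Section ProductSigma.
Context {K : Type} {T : ptopologicalType}.
Implicit Types A B : set (K -> T).

Lemma prod_sigmaC A : prod_sigma A -> prod_sigma (~` A).
Proof. by move=> sA; rewrite -setTD; exact: sigma_algebraCD. Qed.

Lemma prod_sigma_set0 : prod_sigma (set0 : set (K -> T)).
Proof. exact: sigma_algebra0. Qed.

Lemma prod_sigma_setT : prod_sigma (setT : set (K -> T)).
Proof. by rewrite -setC0; apply: prod_sigmaC; exact: prod_sigma_set0. Qed.

Lemma prod_sigma_bigcup (F : nat -> set (K -> T)) :
  (forall n, prod_sigma (F n)) -> prod_sigma (\bigcup_n F n).
Proof. exact: sigma_algebra_bigcup. Qed.

Lemma prod_sigmaI A B : prod_sigma A -> prod_sigma B -> prod_sigma (A `&` B).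
Proof. exact: (@measurableI _ (g_sigma_algebraType _)). Qed.

Lemma prod_sigma_coord k (B : set T) : borel B ->
  prod_sigma ((fun x : K -> T => x k) @^-1` B).
Proof. by move=> bB; apply: sub_sigma_algebra; exists k, B. Qed.

Lemma prod_sigma_preimage d (Omega : measurableType d) (Y : Omega -> K -> T) A :
  (forall k, random_element (fun w => Y w k)) -> prod_sigma A ->
  measurable (Y @^-1` A).
Proof.
move=> mY; move: A; apply: smallest_sub.
  split; first by rewrite /= preimage_set0.
    by move=> A /= mA; rewrite setTD preimage_setC; exact: measurableC.
  by move=> F /= mF; rewrite preimage_bigcup; exact: bigcupT_measurable.
by move=> _ [k [B [bB ->]]]; exact: mY.
Qed.

End ProductSigma.

(** * Open and closed sets of a countable product belong to the product sigma-field *)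

Lemma countable_setT_inj (K : Type) : countable [set: K] ->
  exists c : K -> nat, injective c.
Proof.
move=> /countable_injP[c cinj]; exists c => x y.
by apply: cinj; rewrite in_setT.
Qed.

Section ProductTopology.
Context {R : realType} {T : completePseudoMetricType R} {K : Type}.

Lemma ptws_eval_continuous (k : K) : continuous (fun x : {ptws K -> T} => x k).
Proof. exact: (@proj_continuous {classic K} (fun=> T) k). Qed.

(** A countable product of separable metric spaces is second countable: an open set is the union of
    the cylinders it contains, where cylinders are coded by finite lists of triples of naturals
    (coordinate, centre, radius). *)
Lemma open_prod_sigma (U : set {ptws K -> T}) :
  countable [set: K] -> polish T -> open U -> prod_sigma (U : set (K -> T)).
Proof.
move=> /countable_setT_inj[c cinj] /polish_dense_seq[D dD] oU.
pose B (n m : nat) : set T := (ball (D n) m.+1%:R^-1)°.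
(* If no coordinate has the code [p.1.1], the condition is vacuous and the set is the whole
   product. *)
pose cyl1 (p : nat * nat * nat) : set (K -> T) :=
  [set x | forall k, c k = p.1.1 -> B p.1.2 p.2 (x k)].
pose cyl (s : seq (nat * nat * nat)) : set (K -> T) :=
  [set x | forall p, p \in s -> cyl1 p x].
have mcyl1 p : prod_sigma (cyl1 p).
  have [[k ck]|nk] := pselect (exists k, c k = p.1.1).
    have -> : cyl1 p = (fun x : K -> T => x k) @^-1` B p.1.2 p.2.
      apply/seteqP; split => x /=; first exact.
      by move=> Bx k'; rewrite -ck => /cinj ->.
    by apply: prod_sigma_coord; apply: open_borel; exact: open_interior.
  have -> : cyl1 p = setT; last exact: prod_sigma_setT.
  by apply/seteqP; split => x //= _ k ck; case: nk; exists k.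
have mcyl s : prod_sigma (cyl s).
  elim: s => [|p s ih].
    have -> : cyl [::] = setT; last exact: prod_sigma_setT.
    by apply/seteqP; split.
  have -> : cyl (p :: s) = cyl1 p `&` cyl s; last exact: prod_sigmaI.
  apply/seteqP; split => x /= => [h|[h1 h2] q].
    split; first by apply: h; rewrite mem_head.
    by move=> q qs; apply: h; rewrite in_cons qs orbT.
  by rewrite in_cons => /predU1P[->//|]; exact: h2.
pose G (x : K -> T) : set_system {ptws K -> T} :=
  filter_from [set s | cyl s x] cyl.
have FG x : Filter (G x).
  apply: filter_from_filter; first by exists [::].
  move=> s t sx tx; exists (s ++ t).
    by move=> p; rewrite mem_cat => /orP[]; [exact: sx|exact: tx].
  by move=> y h; split => p ps; apply: h; rewrite mem_cat ps ?orbT.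
(* The cylinders around [x] refine every neighbourhood of [x]; it suffices to treat neighbourhoods
   coming from a single coordinate. *)
have Gx (x : {ptws K -> T}) : G x --> x.
  apply/cvg_sup => k V [W [[C oC <-] Ck CV]]; apply: filterS CV _.
  have : nbhs (x k) C by exact: open_nbhs_nbhs.
  move=> /nbhs_ballP[e e0 eC].
  (* Two points of a ball of radius [r] are within [r + r <= e] of each other, so such a ball
     containing [x k] stays inside [C]. A centre within [r / 2] of [x k] puts [x k] in the interior
     of the ball. *)
  pose m := Num.truncn (2 / e); pose r : R := m.+1%:R^-1.
  have r0 : 0 < r by rewrite invr_gt0.
  have re : r + r <= e.
    rewrite -mulr2n -[_ *+ 2]mulr_natl ler_pdivrMr ?ltr0Sn// mulrC.
    by rewrite -ler_pdivrMr//; apply/ltW; exact: truncnS_gt.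
  have [|n Dx] := dD (x k) (r / 2); first by rewrite divr_gt0.
  exists [:: (c k, n, m)].
    move=> p; rewrite inE => /eqP -> k' /= /cinj ->.
    apply/nbhs_ballP; exists (r / 2); first by rewrite /= divr_gt0.
    by move=> y xy; rewrite [r in ball _ r _]splitr; exact: ball_triangle xy.
  move=> y /(_ (c k, n, m)); rewrite mem_head => /(_ isT k erefl).
  move=> /interior_subset /= Dy; apply: eC; apply: le_ball re _ _.
  apply: (@ball_triangle _ _ (D n)) => //; apply: ball_sym.
  by apply: le_ball Dx; rewrite ler_pdivrMr// ler_peMr ?ltW// ltr1n.
(* Every natural number is decoded as a list; numbers that code no list, or a cylinder not inside
   [U], contribute the empty set. *)
pose F n : set (K -> T) := if @unpickle (seq (nat * nat * nat)) n is Some s then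
  if pselect (cyl s `<=` U) then cyl s else set0 else set0.
have -> : U = \bigcup_n F n.
  apply/seteqP; split => x.
    move=> Ux; have [s sx sU] := Gx x U (open_nbhs_nbhs (conj oU Ux)).
    by exists (pickle s) => //; rewrite /F pickleK; case: pselect.
  move=> [n _]; rewrite /F; case: unpickle => // s.
  by case: pselect => // sU; exact: sU.
apply: prod_sigma_bigcup => n; rewrite /F; case: unpickle => [s|].
  by case: (pselect _) => ?; [exact: mcyl|exact: prod_sigma_set0].
exact: prod_sigma_set0.
Qed.

Lemma closed_prod_sigma (C : set {ptws K -> T}) :
  countable [set: K] -> polish T -> closed C -> prod_sigma (C : set (K -> T)).
Proof.
move=> cK pT cC; rewrite -[X in prod_sigma X]setCK; apply: prod_sigmaC.
by apply: open_prod_sigma => //; exact: closed_openC.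
Qed.

End ProductTopology.

(** * Inner regularity of the law of a countable family by compact sets *)

Lemma preimage_setD {aT rT : Type} (f : aT -> rT) (A B : set rT) :
  f @^-1` (A `\` B) = f @^-1` A `\` f @^-1` B.
Proof. by []. Qed.

Section InnerRegularity.
Context {R : realType} {T : completePseudoMetricType R} {K : Type}.
Context {d : measure_display} {Omega : measurableType d}.
Variables (P : probability Omega R) (Y : Omega -> K -> T).
Hypotheses (cK : countable [set: K]) (pT : polish T).
Hypothesis mY : forall k, random_element (fun w => Y w k).

(** Closedness is recorded beside compactness because it yields the measurability of [C]. *)
Definition inner_regular (A : set (K -> T)) := forall e : R, 0 < e ->
  exists C : set {ptws K -> T},
    [/\ closed C, compact C, C `<=` A & (P (Y @^-1` (A `\` C)) <= e%:E)%E].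

Lemma closed_preimage_measurable (C : set {ptws K -> T}) :
  closed C -> measurable (Y @^-1` C).
Proof.
by move=> cC; apply: prod_sigma_preimage => //; exact: closed_prod_sigma.
Qed.

(** Each coordinate is tight; the product of the compact sets is compact by Tychonoff, and the
    coordinate with code [c k] may lose [e / 2 ^ (c k).+1]. *)
Lemma inner_regular_setT : inner_regular setT.
Proof.
have [c cinj] := countable_setT_inj cK.
move=> e e0.
have /choice[C HC] : forall k, exists C : set T, [/\ compact C, closed C &
    (P ((fun w => Y w k) @^-1` (~` C)) <= (e / (2 ^ (c k).+1)%:R)%:E)%E].
  by move=> k; apply: random_element_tight; rewrite // divr_gt0// ltr0n expn_gt0.
pose box : set {ptws K -> T} := [set x | forall k, C k (x k)].
have clbox : closed box.
  have -> : box = \bigcap_k [set x : {ptws K -> T} | C k (x k)].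
    by apply/seteqP; split => [x h k _|x h k]; exact: h.
  apply: closed_bigI => k _; have [_ clC _] := HC k.
  by apply: (closed_comp _ clC) => x _; exact: ptws_eval_continuous.
exists box; split => //.
  by apply: (@tychonoff {classic K} (fun=> T) C) => k; have [] := HC k.
(* The exceptional events are indexed by codes, so that they form a sequence; a number coding no
   coordinate gives the empty event. *)
pose F n := [set w | exists2 k, c k = n & ~ C k (Y w k)].
have FE k : F (c k) = (fun w => Y w k) @^-1` (~` C k).
  apply/seteqP; split => w /=; last by exists k.
  by move=> [k' /cinj ->]; rewrite ?inE.
have F0 n : (forall k, c k <> n) -> F n = set0.
  by move=> nk; rewrite -subset0 => w [k /nk].
have -> : Y @^-1` (setT `\` box) = \bigcup_n F n.
  apply/seteqP; split => w /=.
    by move=> [_ /existsNP[k nC]]; exists (c k) => //; exists k.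
  by move=> [n _ [k _ nC]]; split => // /(_ k).
apply: probability_bigcup_le => [n| |n].
- have [[k <-]|nk] := pselect (exists k, c k = n).
    rewrite FE; apply: mY; apply: open_borel; apply: closed_openC.
    by have [] := HC k.
  by rewrite F0// => k ck; apply: nk; exists k.
- exact: ltW.
- have [[k <-]|nk] := pselect (exists k, c k = n).
    by rewrite FE; have [] := HC k.
  rewrite F0 ?measure0 ?lee_fin ?divr_ge0 ?ltW//.
  by move=> k ck; apply: nk; exists k.
Qed.

Lemma inner_regular_closed (A : set {ptws K -> T}) : closed A -> inner_regular A.
Proof.
move=> clA e /inner_regular_setT[C [clC cpC _ PC]].
exists (C `&` A); split => //.
- exact: closedI.
- by apply: (subclosed_compact _ cpC) => //; exact: closedI.
- apply: le_trans PC; apply: le_measure; rewrite ?inE.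
  + rewrite preimage_setD; apply: measurableD; apply: closed_preimage_measurable => //.
    exact: closedI.
  + rewrite preimage_setD; apply: measurableD; last exact: closed_preimage_measurable.
    by rewrite preimage_setT.
  + by move=> w /= [Aw nCA]; split => // Cw; exact: nCA.
Qed.

(** Half of [e] pays for compact sets inside all the [A n]. Their finite unions [D n] are compact
    and increase to the full union, so by continuity from above the other half pays for stopping at
    some [D N]. *)
Lemma inner_regular_bigcup (A : nat -> set (K -> T)) :
  (forall n, prod_sigma (A n)) -> (forall n, inner_regular (A n)) ->
  inner_regular (\bigcup_n A n).
Proof.
move=> sA rA e e0.
have e20 : 0 < e / 2 by rewrite divr_gt0.
have /choice[C HC] : forall n, exists C : set {ptws K -> T}, [/\ closed C,
    compact C, C `<=` A n & (P (Y @^-1` (A n `\` C)) <= ((e / 2) / (2 ^ n.+1)%:R)%:E)%E].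
  by move=> n; apply: rA; rewrite divr_gt0// ltr0n expn_gt0.
pose D n : set {ptws K -> T} := [set x | exists2 i, (i < n)%N & C i x].
have clC n : closed (C n) by have [] := HC n.
have clD n : closed (D n) by exact: bigcup_ord_closed.
have cpD n : compact (D n).
  elim: n => [|n ih].
    by have -> : D 0%N = set0; [rewrite -subset0 => x [i]|exact: compact0].
  have -> : D n.+1 = D n `|` C n.
    apply/seteqP; split => x /=.
      move=> [i + Ci]; rewrite ltnS leq_eqVlt => /predU1P[<-|ni]; first by right.
      by left; exists i.
    by move=> [[i ni Ci]|Cn]; [exists i => //; exact: ltnW|exists n].
  by apply: compactU => //; have [] := HC n.
have mA n : measurable (Y @^-1` A n) by exact: prod_sigma_preimage.
have mC n : measurable (Y @^-1` C n) by exact: closed_preimage_measurable.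
have mD n : measurable (Y @^-1` D n) by exact: closed_preimage_measurable.
have mUA : measurable (Y @^-1` \bigcup_n A n).
  by rewrite preimage_bigcup; exact: bigcupT_measurable.
have mUC : measurable (Y @^-1` \bigcup_n C n).
  by rewrite preimage_bigcup; exact: bigcupT_measurable.
have [|||N PN] := @probability_nonincreasing_small _ _ _ P
  (fun n => Y @^-1` (\bigcup_n C n `\` D n)) (e / 2) _ _ _ e20.
- by move=> n; rewrite preimage_setD; exact: measurableD.
- move=> m n mn; apply/subsetPset => w /= [Cw nD]; split => // -[i im Ci].
  by apply: nD; exists i => //; exact: leq_trans mn.
- rewrite -subset0 => w h; have [[n _ Cn] _] := h 0%N I.
  by have [_] := h n.+1 I; apply; exists n.
exists (D N); split => //.
  by move=> x [i _ Ci]; exists i => //; have [_ _ + _] := HC i; apply.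
have PU : (P (Y @^-1` (\bigcup_n A n `\` \bigcup_n C n)) <= (e / 2)%:E)%E.
  apply: (@le_trans _ _ (P (\bigcup_n (Y @^-1` (A n `\` C n))))); last first.
    apply: probability_bigcup_le => [n| |n]; last by have [] := HC n.
    - by rewrite preimage_setD; exact: measurableD.
    - exact: ltW.
  apply: le_measure; rewrite ?inE.
  - by rewrite preimage_setD; exact: measurableD.
  - by apply: bigcupT_measurable => n; rewrite preimage_setD; exact: measurableD.
  - move=> w /= [[n _ An] nC]; exists n => //; split => // Cn; apply: nC.
    by exists n.
rewrite [e]splitr EFinD; apply: le_trans (leeD PU (PN N (leqnn N))).
apply: le_trans (measureU2 _ _ _); last 2 first.
- by rewrite preimage_setD; exact: measurableD.
- by rewrite preimage_setD; exact: measurableD.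
apply: le_measure; rewrite ?inE.
- by rewrite preimage_setD; exact: measurableD.
- by apply: measurableU; rewrite preimage_setD; exact: measurableD.
- move=> w /= [Aw nD]; have [Cw|nC] := pselect ((\bigcup_n C n) (Y w)).
    by right.
  by left.
Qed.

(** The intersection of the compact sets chosen inside each [A n] is closed in a compact set, and it
    loses at most the sum of the individual losses. *)
Lemma inner_regular_bigcap (A : nat -> set (K -> T)) :
  (forall n, prod_sigma (A n)) -> (forall n, inner_regular (A n)) ->
  inner_regular (\bigcap_n A n).
Proof.
move=> sA rA e e0.
have /choice[C HC] : forall n, exists C : set {ptws K -> T}, [/\ closed C,
    compact C, C `<=` A n & (P (Y @^-1` (A n `\` C)) <= (e / (2 ^ n.+1)%:R)%:E)%E].
  by move=> n; apply: rA; rewrite divr_gt0// ltr0n expn_gt0.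
have clC n : closed (C n) by have [] := HC n.
have clI : closed (\bigcap_n C n) by exact: closed_bigI.
have mA n : measurable (Y @^-1` A n) by exact: prod_sigma_preimage.
have mC n : measurable (Y @^-1` C n) by exact: closed_preimage_measurable.
exists (\bigcap_n C n); split => //.
- have [_ cp0 _ _] := HC 0%N.
  by apply: (subclosed_compact _ cp0) => // x; exact.
- by move=> x Cx n _; have [_ _ + _] := HC n; apply; exact: Cx.
- apply: (@le_trans _ _ (P (\bigcup_n (Y @^-1` (A n `\` C n))))); last first.
    apply: probability_bigcup_le => [n| |n]; last by have [] := HC n.
    - by rewrite preimage_setD; exact: measurableD.
    - exact: ltW.
  apply: le_measure; rewrite ?inE.
  - rewrite preimage_setD; apply: measurableD; last exact: closed_preimage_measurable.
    by rewrite preimage_bigcap; exact: bigcapT_measurable.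
  - by apply: bigcupT_measurable => n; rewrite preimage_setD; exact: measurableD.
  - move=> w /= [Aw nC]; have [n nCn] : exists n, ~ C n (Y w).
      by apply/existsNP => h; apply: nC => n _; exact: h.
    by exists n => //; split => //; exact: Aw.
Qed.

(** An open set of a metric space is a countable union of closed sets, so open cylinders are inner
    regular. Asking for the complement as well makes the class of good [B] a sigma-field, since
    countable unions and intersections preserve inner regularity. *)
Lemma inner_regular_coord k (B : set T) : borel B ->
  inner_regular ((fun x : K -> T => x k) @^-1` B) /\
  inner_regular (~` ((fun x : K -> T => x k) @^-1` B)).
Proof.
have key U : open U -> inner_regular ((fun x : K -> T => x k) @^-1` U).
  move=> oU.
  (* [V n] is an open neighbourhood of the complement of [U] that shrinks to it, because a point of
     [U] has positive distance from that complement. *)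
  pose V n : set T := \bigcup_(y in ~` U) (ball y n.+1%:R^-1)°.
  have oV n : open (V n) by apply: bigcup_open => y _; exact: open_interior.
  have -> : U = \bigcup_n (~` V n).
    apply/seteqP; split => x.
      move=> Ux; have /nbhs_ballP[e e0 eU] : nbhs x U by exact: open_nbhs_nbhs.
      exists (Num.truncn e^-1) => // -[y nU /interior_subset yx].
      apply: nU; apply: eU; apply: ball_sym; apply: le_ball yx.
      by rewrite invf_ple ?posrE//; apply/ltW; exact: truncnS_gt.
    move=> [n _ nV]; apply: contrapT => nU; apply: nV; exists x => //.
    by apply: nbhsx_ballx; rewrite invr_gt0.
  rewrite preimage_bigcup; apply: inner_regular_bigcup => n.
    by apply: prod_sigma_coord; apply: closed_borel; exact: open_closedC.
  apply: inner_regular_closed.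
  apply: (closed_comp (f := fun x : {ptws K -> T} => x k)).
    by move=> x _; exact: ptws_eval_continuous.
  exact: open_closedC.
pose S : set (set T) := [set B | [/\ borel B,
  inner_regular ((fun x : K -> T => x k) @^-1` B) &
  inner_regular (~` ((fun x : K -> T => x k) @^-1` B))]].
suff BS : @borel T `<=` S by move=> /BS[].
apply: smallest_sub.
  split.
  - split; first exact: sigma_algebra0.
    + by rewrite preimage_set0; apply: inner_regular_closed; exact: closed0.
    + by rewrite preimage_set0 setC0; exact: inner_regular_setT.
  - move=> A [bA rA rA']; split; first exact: sigma_algebraCD.
    + by rewrite setTD preimage_setC.
    + by rewrite setTD preimage_setC setCK.
  - move=> F SF; split.
    + by apply: sigma_algebra_bigcup => n; have [] := SF n.
    + rewrite preimage_bigcup; apply: inner_regular_bigcup => n.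
        by apply: prod_sigma_coord; have [] := SF n.
      by have [] := SF n.
    + rewrite preimage_bigcup setC_bigcup; apply: inner_regular_bigcap => n.
        by apply: prod_sigmaC; apply: prod_sigma_coord; have [] := SF n.
      by have [] := SF n.
move=> U oU; split; [exact: open_borel|exact: key|].
rewrite preimage_setC; apply: inner_regular_closed.
apply: (closed_comp (f := fun x : {ptws K -> T} => x k)).
  by move=> x _; exact: ptws_eval_continuous.
exact: open_closedC.
Qed.

Lemma prod_sigma_inner_regular (A : set (K -> T)) :
  prod_sigma A -> inner_regular A.
Proof.
pose S : set (set (K -> T)) := [set A | [/\ prod_sigma A, inner_regular A &
  inner_regular (~` A)]].
suff BS : @prod_sigma K T `<=` S by move=> /BS[].
apply: smallest_sub.
  split.
  - split; first exact: prod_sigma_set0.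
    + by apply: inner_regular_closed; exact: closed0.
    + by rewrite setC0; exact: inner_regular_setT.
  - by move=> B [sB rB rB']; rewrite setTD; split; rewrite ?setCK//; exact: prod_sigmaC.
  - move=> F SF; split.
    + by apply: prod_sigma_bigcup => n; have [] := SF n.
    + by apply: inner_regular_bigcup => n; have [] := SF n.
    + rewrite setC_bigcup; apply: inner_regular_bigcap => n; have [] := SF n => //.
      by move=> ? _ _; exact: prod_sigmaC.
move=> _ [k [B [bB ->]]]; have [? ?] := inner_regular_coord k bB.
by split => //; exact: prod_sigma_coord.
Qed.

End InnerRegularity.

(** * Upper sets and upper closures of compact sets *)

Definition upper_set (K T : Type) (le : T -> T -> Prop) (A : set (K -> T)) :=
  forall x y : K -> T, (forall k, le (x k) (y k)) -> A x -> A y.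

(** When [phi] includes a smaller index type [K'] into [K], this is the upper closure of the
    projection of [C] to the coordinates in [K']. *)
Definition up_along (K K' T : Type) (le : T -> T -> Prop) (phi : K' -> K)
  (C : set (K -> T)) : set (K' -> T) :=
  [set y | exists2 x, C x & forall k, le (x (phi k)) (y k)].

Lemma near_not_le (T : topologicalType) (le : T -> T -> Prop) (a b : T) :
  closed_partial_order le -> ~ le a b ->
  \forall a' \near a & b' \near b, ~ le a' b'.
Proof.
move=> [_ _ _ clo] nab.
have : nbhs (a, b) (~` [set p : T * T | le p.1 p.2]).
  by apply: open_nbhs_nbhs; split => //; exact: closed_openC.
exact.
Qed.

Section UpperClosure.
Context {R : realType} {T : completePseudoMetricType R} {K : Type}.
Variable le : T -> T -> Prop.
Hypothesis le_closed : closed_partial_order le.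

Lemma up_along_upper (K' : Type) (phi : K' -> K) (C : set (K -> T)) :
  upper_set le (up_along le phi C).
Proof.
have [_ _ tr _] := le_closed => y z yz [x Cx xy].
by exists x => // k; exact: tr (xy k) (yz k).
Qed.

(** If [y] lies outside, each [x] in [C] fails at some coordinate, and by closedness of the order
    the failure persists near [x] and [y]. Compactness of [C] makes one neighbourhood of [y] serve
    all [x]. *)
Lemma up_along_closed (K' : Type) (phi : K' -> K) (C : set {ptws K -> T}) :
  compact C -> closed (up_along le phi C : set {ptws K' -> T}).
Proof.
move=> /compact_near_coveringP cC; rewrite -openC openE => y ny.
have : \forall y' \near y, C `<=`
    (fun x : {ptws K -> T} => ~ forall k, le (x (phi k)) (y' k)).
  apply: (cC {ptws K' -> T} (nbhs y) (fun y' x => ~ forall k, le (x (phi k)) (y' k))).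
  move=> x Cx; have [k nk] : exists k, ~ le (x (phi k)) (y k).
    by apply/existsNP => xy; apply: ny; exists x.
  have [[A B] /= [xA yB] AB] := near_not_le le_closed nk.
  exists ((fun x : {ptws K -> T} => x (phi k)) @^-1` A,
          (fun y : {ptws K' -> T} => y k) @^-1` B).
    by split; apply: ptws_eval_continuous.
  by move=> [x' y'] /= [Ax' By'] /(_ k); exact: AB (x' (phi k), y' k) _.
by apply: filterS => y' h [x /h].
Qed.

(* Were there no such x, every x in C would fail at some coordinate, and by the
   tube lemma all of C would fail on a single F n. *)
Lemma compact_le_exhaust (F : nat -> set K) (C : set {ptws K -> T}) (y : K -> T) :
  (forall k, \forall n \near \oo, F n k) -> compact C ->
  (forall n, exists2 x, C x & forall k, F n k -> le (x k) (y k)) ->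
  exists2 x, C x & forall k, le (x k) (y k).
Proof.
move=> FT /compact_near_coveringP cC yF; apply: contrapT => ny.
have : \forall n \near \oo, C `<=`
    (fun x : {ptws K -> T} => ~ forall k, F n k -> le (x k) (y k)).
  apply: (cC nat \oo (fun n (x : {ptws K -> T}) => ~ forall k, F n k -> le (x k) (y k))).
  move=> x Cx; have [k nk] : exists k, ~ le (x k) (y k).
    by apply/existsNP => xy; apply: ny; exists x.
  have [[A B] /= [xA yB] AB] := near_not_le le_closed nk.
  exists ((fun x : {ptws K -> T} => x k) @^-1` A, [set n | F n k]).
    by split; [exact: ptws_eval_continuous|exact: FT].
  move=> [x' n] /= [Ax' Fnk] /(_ k Fnk).
  by apply: (AB (x' k, y k)); split => //; exact: nbhs_singleton.
by move=> /filter_ex[n nC]; have [x /nC] := yF n.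
Qed.

End UpperClosure.

(** * Approximation of upper sets by upper sets in finitely many coordinates *)

Lemma inj_countable (K : Type) (c : K -> nat) : injective c -> countable [set: K].
Proof. by move=> ci; apply/countable_injP; exists c => x y _ _; exact: ci. Qed.

Lemma sval_inj (K : Type) (J : set K) : injective (@proj1_sig K J).
Proof.
move=> [x px] [y py] /= xy; move: xy px py => -> px py.
by congr exist; exact: Prop_irrelevance.
Qed.

Section FiniteDimensionalApproximation.
Context {R : realType} {T : completePseudoMetricType R}.
Context {d : measure_display} {Omega : measurableType d}.
Variables (le : T -> T -> Prop) (P : probability Omega R).
Variables (I : Type) (X : I -> Omega -> T) (c : I -> nat).
Hypotheses (hPOP : POP le) (cinj : injective c).
Hypothesis mX : forall i, random_element (X i).

(** As [c] is injective, these are finite sets increasing to the whole of [I], so limits over finite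
    index sets become limits of sequences. *)
Definition initial (n : nat) : set I := [set i | (c i < n)%N].

Lemma initial_finite n : finite_set (initial n).
Proof.
apply: (@finite_preimage _ _ `I_n c); last exact: finite_II.
by move=> x y _ _; exact: cinj.
Qed.

Definition initial_family n (j : {i : I | initial n i}) := X (proj1_sig j).

(** Association of the subfamily on [initial n] speaks of sets of indices of that subtype, so [J]
    has to be transported there. *)
Definition initial_trace n (J : set I) : set {i : I | initial n i} :=
  fun j => J (proj1_sig j).

Definition initial_incl n (J : set I) (j : {j | @initial_trace n J j}) :
  {i | J i} := exist J (proj1_sig (proj1_sig j)) (proj2_sig j).

(** The event [Einf] that all cylinder conditions hold lies between the events of [C] and [A], so
    the symmetric difference is covered by that of [A] minus [C] and by [E n] minus [Einf], each of
    probability at most [e / 2]. All large [n] are allowed so that two upper sets can be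
    approximated with the same [n]. *)
Lemma upper_set_approx (J : set I) (A : set ({i | J i} -> T)) (e : R) :
  prod_sigma A -> upper_set le A -> 0 < e ->
  exists N, forall n, (N <= n)%N ->
  exists A' : set ({j | @initial_trace n J j} -> T),
    [/\ prod_sigma A', upper_set le A' &
     (P (subfam X J @^-1` A `+`
         subfam (@initial_family n) (@initial_trace n J) @^-1` A') <= e%:E)%E].
Proof.
have [pT lec] := hPOP; move=> sA uA e0.
have cJ : countable [set: {i | J i}].
  by apply: (@inj_countable _ (c \o @proj1_sig I J)); apply: inj_comp cinj _; exact: sval_inj.
have cJn n : countable [set: {j | @initial_trace n J j}].
  apply: (@inj_countable _ (c \o @proj1_sig _ _ \o @proj1_sig _ _)).
  by do 2?[apply: inj_comp; last exact: sval_inj].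
have mY k : random_element (fun w => subfam X J w k) by exact: mX.
have e20 : 0 < e / 2 by rewrite divr_gt0.
have [C [clC cpC CA PC]] :=
  prod_sigma_inner_regular P cJ pT mY sA e20.
pose A' n := up_along le (@initial_incl n J) C.
have sA' n : prod_sigma (A' n).
  by apply: closed_prod_sigma => //; exact: up_along_closed.
pose E n := subfam (@initial_family n) (@initial_trace n J) @^-1` (A' n).
have mE n : measurable (E n) by apply: prod_sigma_preimage (sA' n) => k; exact: mX.
(* Membership is rephrased with indices of [J] and a bound on their code, which removes the nested
   subtypes. *)
have EP n w : E n w <-> exists2 x, C x &
    forall k : {i | J i}, initial n (proj1_sig k) -> le (x k) (subfam X J w k).
  split=> -[x Cx xw]; exists x => //.
    move=> [i Ji] ni.
    exact: (xw (exist (@initial_trace n J) (exist (initial n) i ni) Ji)).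
  by move=> [[i ni] Ji]; exact: (xw (exist J i Ji) ni).
pose Einf := \bigcap_n E n.
have mEinf : measurable Einf by exact: bigcapT_measurable.
have EinfA w : Einf w -> A (subfam X J w).
  move=> Ew; have [||x /CA Ax xw] := @compact_le_exhaust _ _ _ le lec
    (fun n k => initial n (proj1_sig k)) C (subfam X J w) _ cpC.
  - by move=> k; exists (c (proj1_sig k)).+1.
  - by move=> n; apply/EP; exact: Ew.
  - exact: uA xw Ax.
have CEinf w : C (subfam X J w) -> Einf w.
  move=> Cw n _; apply/EP; exists (subfam X J w) => // k _.
  by have [rf _ _ _] := lec; exact: rf.
have [|||N PN] := @probability_nonincreasing_small _ _ _ P
  (fun n => E n `\` Einf) (e / 2) _ _ _ e20.
- by move=> n; exact: measurableD.
- move=> m n mn; apply/subsetPset => w [/EP[x Cx xw] nE]; split => //.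
  by apply/EP; exists x => // k km; apply: xw; exact: leq_trans mn.
- rewrite -subset0 => w h; have [_ nE] := h 0%N Logic.I.
  by apply: nE => n _; have [] := h n Logic.I.
exists N => n Nn; exists (A' n); split => //; first exact: up_along_upper.
rewrite [e]splitr EFinD; apply: le_trans (leeD PC (PN n Nn)).
have mA : measurable (subfam X J @^-1` A) by exact: prod_sigma_preimage.
have mAC : measurable (subfam X J @^-1` (A `\` C)).
  by apply: (measurableD mA); exact: (closed_preimage_measurable cJ pT mY clC).
have mEE : measurable (E n `\` Einf) by exact: measurableD.
apply: le_trans (measureU2 _ mAC mEE); apply: le_measure; rewrite ?inE.
- by apply: measurableU; apply: measurableD => //; exact: (mE n).
- exact: measurableU.
- move=> w [[Aw nE]|[Ew nA]].
    by left; split => // /CEinf /(_ n Logic.I).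
  by right; split => // /EinfA.
Qed.

End FiniteDimensionalApproximation.
Arguments initial_trace {I} c n J _.
Arguments initial_family {R T d Omega I} X c n _.

(** * Association in terms of covariances and passage to the limit from finite subfamilies *)

Section Association.
Context {R : realType} {T : completePseudoMetricType R}.
Context {d : measure_display} {Omega : measurableType d}.
Variables (le : T -> T -> Prop) (P : probability Omega R).

Lemma bmn_fun_bounded_measurable (K : Type) (Y : Omega -> K -> T)
    (f : (K -> T) -> R) :
  (forall k, random_element (fun w => Y w k)) -> bmn_fun le f ->
  bounded_measurable (fun w => f (Y w)).
Proof.
move=> mY [[M fM] mf _]; split; last by exists M.
apply: (measurability _ (RGenOInfty.measurableE R)) => //.
move=> /= _ [_ [a ->] <-]; rewrite setTI.
apply: (@prod_sigma_preimage _ _ _ _ Y (f @^-1` `]a, +oo[)) => //.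
by apply: mf; apply: open_borel; exact: interval_open.
Qed.

Lemma bmn_fun_superlevel (K : Type) (f : (K -> T) -> R) (t : R) :
  bmn_fun le f ->
  prod_sigma [set x | t < f x] /\ upper_set le [set x | t < f x].
Proof.
move=> [_ mf fle]; split; last by move=> x y /fle xy /= /lt_le_trans; exact.
have -> : [set x | t < f x] = f @^-1` `]t, +oo[.
  by apply/seteqP; split => x /=; rewrite in_itv/= andbT.
by apply: mf; apply: open_borel; exact: interval_open.
Qed.

(** Makes the approximating upper sets available as test functions for the finite subfamilies. *)
Lemma bmn_fun_indic (K : Type) (A : set (K -> T)) :
  prod_sigma A -> upper_set le A -> bmn_fun le (\1_A : (K -> T) -> R).
Proof.
move=> sA uA; split.
- by exists 1 => x; rewrite indicE; case: (_ \in _); rewrite ?normr1 ?normr0.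
- move=> B _; rewrite preimage_indic.
  case: ifPn => _; case: ifPn => _ //; [exact: prod_sigma_setT|
    exact: prod_sigmaC|exact: prod_sigma_set0].
- move=> x y xy; rewrite !indicE ler_nat.
  case: (boolP (x \in A)) => // /set_mem /(uA _ _ xy) /mem_set.
  by rewrite -/(is_true _) => ->.
Qed.

Lemma bounded_measurable_EFin_Rintegral (U : Omega -> R) :
  bounded_measurable U -> (\int[P]_w (U w)%:E)%E = (\int[P]_w U w)%:E.
Proof.
move=> /(bounded_measurable_integrable P) iU.
by rewrite /Rintegral fineK//; exact: integrable_fin_num.
Qed.

Lemma negative_cov (U V : Omega -> R) :
  bounded_measurable U -> bounded_measurable V ->
  (\int[P]_w (U w * V w)%:E <= (\int[P]_w (U w)%:E) * (\int[P]_w (V w)%:E))%E =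
  (0 <= -1 * cov P U V).
Proof.
move=> bU bV; rewrite !bounded_measurable_EFin_Rintegral//; last first.
  exact: bounded_measurableM.
by rewrite -EFinM lee_fin mulN1r oppr_ge0 subr_le0.
Qed.

Lemma positive_cov (U V : Omega -> R) :
  bounded_measurable U -> bounded_measurable V ->
  ((\int[P]_w (U w)%:E) * (\int[P]_w (V w)%:E) <= \int[P]_w (U w * V w)%:E)%E =
  (0 <= 1 * cov P U V).
Proof.
move=> bU bV; rewrite !bounded_measurable_EFin_Rintegral//; last first.
  exact: bounded_measurableM.
by rewrite -EFinM lee_fin mul1r subr_ge0.
Qed.

Lemma cov_indic_ge0_approx (s : R) (A B : set Omega) :
  measurable A -> measurable B ->
  (forall e, 0 < e -> exists A' B', [/\ measurable A', measurable B',
    (P (A `+` A') <= e%:E)%E, (P (B `+` B') <= e%:E)%E &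
    0 <= s * cov P (\1_A') (\1_B')]) ->
  0 <= s * cov P (\1_A) (\1_B).
Proof.
move=> mA mB AB; apply/ler_addgt0Pl => e e0.
(* By [cov_indic_approx] an error [e'] in both sets changes the scaled covariance by at most
   [|s| * 4 * e']; the added 1 keeps the divisor positive. *)
have C0 : 0 < `|s| * 4 + 1 by rewrite ltr_wpDl// mulr_ge0.
have [A' [B' [mA' mB' PA PB s0]]] := AB _ (divr_gt0 e0 C0).
have := cov_indic_approx mA mA' mB mB' PA PB.
set e' := e / _ => D4e.
have De : `|s * (cov P (\1_A) (\1_B) - cov P (\1_A') (\1_B'))| <= e.
  rewrite normrM; apply: le_trans (ler_wpM2l (normr_ge0 s) D4e) _.
  have -> : e = e' * (`|s| * 4 + 1) by rewrite /e' divfK// gt_eqF.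
  have : 0 < e' by exact: divr_gt0.
  by nra.
by move: De; rewrite ler_norml mulrBr => /andP[De _]; lra.
Qed.

(** [J] and [J'] are kept arbitrary: [J'] becomes the complement of [J] for negative association and
    [J] itself for positive association. *)
Lemma cov_ge0_of_initial (I : Type) (X : I -> Omega -> T) (c : I -> nat) (s : R)
    (J J' : set I) (f : ({i | J i} -> T) -> R) (g : ({i | J' i} -> T) -> R) :
  POP le -> injective c -> (forall i, random_element (X i)) ->
  (forall n (f' : ({j | initial_trace c n J j} -> T) -> R)
            (g' : ({j | initial_trace c n J' j} -> T) -> R),
    bmn_fun le f' -> bmn_fun le g' ->
    0 <= s * cov P
      (fun w => f' (subfam (initial_family X c n) (initial_trace c n J) w))
      (fun w => g' (subfam (initial_family X c n) (initial_trace c n J') w))) ->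
  bmn_fun le f -> bmn_fun le g ->
  0 <= s * cov P (fun w => f (subfam X J w)) (fun w => g (subfam X J' w)).
Proof.
move=> hPOP cinj mX sfin bf bg.
have mXJ (L : set I) k : random_element (fun w => subfam X L w k) by exact: mX.
apply: cov_superlevels_ge0 => [||t u].
- exact: bmn_fun_bounded_measurable bf.
- exact: bmn_fun_bounded_measurable bg.
have [sA uA] := bmn_fun_superlevel t bf; have [sB uB] := bmn_fun_superlevel u bg.
apply: cov_indic_ge0_approx => [||e e0].
- exact: (prod_sigma_preimage (mXJ J) sA).
- exact: (prod_sigma_preimage (mXJ J') sB).
have [N1 HA] := upper_set_approx P hPOP cinj mX sA uA e0.
have [N2 HB] := upper_set_approx P hPOP cinj mX sB uB e0.
(* Both upper sets are approximated at the same level, so that a single finite subfamily carries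
   both indicators. *)
have [A' [sA' uA' PA]] := HA _ (leq_maxl N1 N2).
have [B' [sB' uB' PB]] := HB _ (leq_maxr N1 N2).
set n := maxn N1 N2 in A' sA' uA' PA B' sB' uB' PB.
have mXn (L : set I) k : random_element
  (fun w => subfam (initial_family X c n) (initial_trace c n L) w k) by exact: mX.
exists (subfam (initial_family X c n) (initial_trace c n J) @^-1` A').
exists (subfam (initial_family X c n) (initial_trace c n J') @^-1` B').
split => //.
- exact: (prod_sigma_preimage (mXn J) sA').
- exact: (prod_sigma_preimage (mXn J') sB').
exact: (sfin n _ _ (bmn_fun_indic sA' uA') (bmn_fun_indic sB' uB')).
Qed.

End Association.

Theorem theorem3p3 (R : realType) (T : completePseudoMetricType R)
  (le : T -> T -> Prop) (d : measure_display) (Omega : measurableType d)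
  (P : probability Omega R) (I : Type) (X : I -> Omega -> T) :
  POP le -> countable [set: I] -> (forall i, random_element (X i)) ->
  ((forall J : set I, finite_set J ->
      negatively_associated P le (fun j : {i : I | J i} => X (proj1_sig j))) ->
    negatively_associated P le X) /\
  ((forall J : set I, finite_set J ->
      positively_associated P le (fun j : {i : I | J i} => X (proj1_sig j))) ->
    positively_associated P le X).
Proof.
move=> hPOP /countable_setT_inj[c cinj] mX.
have bX (J : set I) (f : _ -> R) : bmn_fun le f ->
    bounded_measurable (fun w => f (subfam X J w)).
  move=> bf; have mXJ k : random_element (fun w => subfam X J w k) by exact: mX.
  exact: (bmn_fun_bounded_measurable mXJ bf).
have bXn n (J : set {i | initial c n i}) (f : _ -> R) : bmn_fun le f ->
    bounded_measurable (fun w => f (subfam (initial_family X c n) J w)).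
  move=> bf; have mXn k : random_element
      (fun w => subfam (initial_family X c n) J w k) by exact: mX.
  exact: (bmn_fun_bounded_measurable mXn bf).
split=> finX J f g bf bg.
- rewrite negative_cov; [|exact: bX..].
  apply: (cov_ge0_of_initial hPOP cinj mX _ bf bg) => n f' g' bf' bg'.
  rewrite -negative_cov; [|exact: bXn..].
  (* The trace of the complement of [J] is by conversion the complement of the trace of [J], so [g']
     has the type that negative association of the finite subfamily requires. *)
  exact: (finX _ (initial_finite cinj n) (initial_trace c n J) f' g' bf' bg').
- rewrite positive_cov; [|exact: bX..].
  apply: (cov_ge0_of_initial hPOP cinj mX _ bf bg) => n f' g' bf' bg'.
  rewrite -positive_cov; [|exact: bXn..].
  exact: (finX _ (initial_finite cinj n) (initial_trace c n J) f' g' bf' bg').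
Qed.
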